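(* Let $X$ be a compact space and let $a,b\in X$ be pin equivalent in $X$. Then there is a closed symmetric subset $Y$ of $X^2$ such that the first coordinate projection $f\colon Y\to X$, $f(x,y)=x$, is a continuous surjection, and the continuous involution $g\colon Y\to Y$, $g(x,y)=(y,x)$, satisfies $g(f^{-1}\{a\})=f^{-1}\{b\}$.
   Context: All spaces are assumed to be Hausdorff. Points $a,b$ in a compact space $X$ are pin equivalent (in $X$) if there exist a compact space $Y$, a continuous surjection $f\colon Y\to X$, and a homeomorphism $g\colon Y\to Y$ such that $g(f^{-1}\{a\})=f^{-1}\{b\}$. A subset $Y$ of $X^2$ is symmetric if $(x,y)\in Y$ implies $(y,x)\in Y$. *)

(* Defs.v *)
From mathcomp Require Import all_boot.
From mathcomp Require Import boolp classical_sets functions topology.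
Set Implicit Arguments.
Unset Strict Implicit.
Unset Printing Implicit Defensive.
Local Open Scope classical_set_scope.

(* All spaces are Hausdorff by convention, so "compact space" includes it. *)
Definition compact_space (X : topologicalType) : Prop :=
  compact [set: X] /\ hausdorff_space X.

Definition homeomorphism (X Y : topologicalType) (g : X -> Y) : Prop :=
  exists h : Y -> X,
    [/\ cancel g h, cancel h g, continuous g & continuous h].

Definition pin_equivalent (X : topologicalType) (a b : X) : Prop :=
  exists (Y : topologicalType) (f : Y -> X) (g : Y -> Y),
    [/\ compact_space Y,
        continuous f,
        set_surj [set: Y] [set: X] f,
        homeomorphism g &
        g @` (f @^-1` [set a]) = f @^-1` [set b] ].

Definition symmetric_set (T : Type) (Y : set (T * T)) : Prop :=
  forall x y : T, Y (x, y) -> Y (y, x).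

(* The two maps below live on the subspace [set_type Y] of [X * X]. *)
Definition proj_fst (T : Type) (Y : set (T * T)) (z : set_type Y) : T :=
  (set_val z).1.

Definition coord_swap (T : Type) (Y : set (T * T)) (sY : symmetric_set Y)
    (z : set_type Y) : set_type Y :=
  let: exist (x, y) xyY := z in exist _ (y, x) (mem_set (sY x y (set_mem xyY))).

Lemma set_val_coord_swap (T : Type) (Y : set (T * T)) (sY : symmetric_set Y)
    (z : set_type Y) :
  set_val (coord_swap sY z) = ((set_val z).2, (set_val z).1).
Proof. by case: z => -[x y] xyY. Qed.

(* Main.v *)
(** Let the pin equivalence of [a <> b] be witnessed by [f : Z -> X] and
    [h : Z -> Z], and put [fh := f \o h], so that [f z = a] iff [fh z = b].
    The relation formed by the pairs [(f z, fh z)] and their transposes is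
    closed, symmetric and total, but [a] may have relatives other than [b], as
    [fh z = a] says nothing about [f z].  Separating [a] and [b] by disjoint
    open sets [U] and [V], one therefore keeps only the [z] with [f z] outside
    [V] and [fh z] outside [U].  Totality is restored by adding the diagonal
    of a closed set [C] that contains neither [a] nor [b]. *)

Require Import Defs.
From mathcomp Require Import all_boot.
From mathcomp Require Import boolp classical_sets functions topology.
Local Open Scope classical_set_scope.

Lemma hausdorff_prod (S T : topologicalType) :
  hausdorff_space S -> hausdorff_space T -> hausdorff_space (S * T)%type.
Proof.
move=> hS hT [p1 p2] [q1 q2] pq; congr pair.
- apply: hS => A B pA qB.
  have [|| [x y] /= [Ax Bx]] := pq (fst @^-1` A) (fst @^-1` B).
  + exact: (@cvg_fst _ _ (nbhs p1) (nbhs p2) _ A pA).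
  + exact: (@cvg_fst _ _ (nbhs q1) (nbhs q2) _ B qB).
  by exists x.
- apply: hT => A B pA qB.
  have [|| [x y] /= [Ay By]] := pq (snd @^-1` A) (snd @^-1` B).
  + exact: (@cvg_snd _ _ (nbhs p1) (nbhs p2) _ A pA).
  + exact: (@cvg_snd _ _ (nbhs q1) (nbhs q2) _ B qB).
  by exists y.
Qed.

Lemma continuous_pair (Z S T : topologicalType) (u : Z -> S) (v : Z -> T) :
  continuous u -> continuous v -> continuous (fun z => (u z, v z)).
Proof. by move=> cu cv z; apply: cvg_pair; [exact: cu | exact: cv]. Qed.

Lemma closed_image (S T : topologicalType) (u : S -> T) (A : set S) :
  compact [set: S] -> hausdorff_space T -> continuous u ->
  closed A -> closed (u @` A).
Proof.
move=> cS hT cu clA; apply: compact_closed => //; apply: continuous_compact.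
  exact: continuous_subspaceT.
exact: subclosed_compact clA cS (@subsetT _ A).
Qed.

(** Reduces the theorem to building a relation. Totality and the last two hypotheses make the fibres
    of [f] over [a] and [b] the single points [(a, b)] and [(b, a)], which the swap exchanges. *)
Lemma symmetric_closed_relation (X : topologicalType) (a b : X)
    (Y : set (X * X)) (sY : symmetric_set Y) :
  closed Y -> (forall x, exists y, Y (x, y)) ->
  (forall y, Y (a, y) -> y = b) -> (forall y, Y (b, y) -> y = a) ->
  let f : set_type Y -> X := @proj_fst X Y in
  let g : set_type Y -> set_type Y := coord_swap sY in
  [/\ closed Y,
      continuous f /\ set_surj [set: set_type Y] [set: X] f,
      continuous g /\ involutive g &
      g @` (f @^-1` [set a]) = f @^-1` [set b] ].
Proof.
move=> clY totY Ya Yb f g.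
have gE z : set_val (g z) = ((set_val z).2, (set_val z).1).
  exact: set_val_coord_swap.
have valY (z : set_type Y) : Y ((set_val z).1, (set_val z).2).
  by rewrite -surjective_pairing; exact: set_valP.
have gK : involutive g.
  by move=> z; apply: val_inj; rewrite -!set_valE !gE; case: (set_val z).
have cval : continuous (set_val : set_type Y -> X * X).
  exact: initial_continuous.
have cf : continuous f.
  move=> z; apply: (@continuous_comp _ _ _ (set_val : set_type Y -> _) fst).
    exact: cval.
  exact: cvg_fst.
split => //.
- split=> // x _; have [y xyY] := totY x.
  by exists (exist _ (x, y) (mem_set xyY)).
- split=> //; apply: continuous_comp_initial.
  have -> : set_val \o g = (fun z => ((set_val z).2, (set_val z).1)).
    by apply/funext => z; exact: gE.
  apply: continuous_pair => // z.
  apply: (@continuous_comp _ _ _ (set_val : set_type Y -> _) snd).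
    exact: cval.
  exact: cvg_snd.
- apply/seteqP; split=> [_ [z /= za <-]|z /= zb].
    rewrite /f /proj_fst gE /=; apply: Ya.
    by move: (valY z); rewrite -[X in Y (X, _)]/(f z) za.
  exists (g z); last exact: gK.
  rewrite /= /f /proj_fst gE /=; apply: Yb.
  by move: (valY z); rewrite -[X in Y (X, _)]/(f z) zb.
Qed.

Theorem corollary2p2 (X : topologicalType) (a b : X)
    (cX : compact_space X) (pin_ab : pin_equivalent a b) :
  exists (Y : set (X * X)) (sY : symmetric_set Y),
    let f : set_type Y -> X := @proj_fst X Y in
    let g : set_type Y -> set_type Y := coord_swap sY in
    [/\ closed Y,
        continuous f /\ set_surj [set: set_type Y] [set: X] f,
        continuous g /\ involutive g &
        g @` (f @^-1` [set a]) = f @^-1` [set b] ].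
Proof.
have [Z [f [h [[cZ _] cf sf [k [hK kK ch _]] hab]]]] := pin_ab.
have [cptX hX] := cX.
have hXX : hausdorff_space (X * X)%type by exact: hausdorff_prod.
have cdiag : continuous (fun x : X => (x, x)).
  by apply: continuous_pair => x; exact: cvg_id.
(* If [a = b], the diagonal of [X] serves, as it relates each point only to itself. *)
have [<-{b pin_ab hab}|/eqP neq_ab] := EM (a = b).
  have sY : symmetric_set (range (fun x : X => (x, x))).
    by move=> x y [z _ [<- <-]]; exists z.
  exists _, sY; apply: symmetric_closed_relation.
  - exact: closed_image closedT.
  - by move=> x; exists x, x.
  - by move=> y [z _ [<- <-]].
  - by move=> y [z _ [<- <-]].
pose fh := f \o h.
have cfh : continuous fh by move=> z; apply: continuous_comp; [exact: ch | exact: cf].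
have sfh x : exists z, fh z = x.
  by have [z _ zx] := sf x I; exists (k z); rewrite /fh /= kK.
have fhP z : (f z = a) <-> (fh z = b).
  split=> [za|zb].
    have : (h @` (f @^-1` [set a])) (h z) by exists z.
    by rewrite hab.
  have : (f @^-1` [set b]) (h z) by [].
  by rewrite -hab => -[w wa /(can_inj hK) <-].
move: hX => /[dup] hX; rewrite open_hausdorff => /(_ a b neq_ab).
case=> -[U V] /= [/set_mem aU /set_mem bV] [oU oV /eqP UV0].
have nUV x : U x -> ~ V x.
  by move=> Ux Vx; have : (U `&` V) x by []; rewrite UV0.
pose P := f @^-1` (~` V) `&` fh @^-1` (~` U).
(* An open set containing the common fibre of [f] over [a] and of [fh] over [b]; it lies in [P]
   because [U] and [V] are disjoint. *)
pose W := f @^-1` U `&` fh @^-1` V.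
have WP z : W z -> P z.
  by move=> [Uz Vz]; split=> [|/nUV]; [exact: nUV|exact].
have clP : closed P.
  by apply: closedI; apply: preimage_closed => //; exact: open_closedC.
have clW : closed (~` W).
  by apply: open_closedC; apply: openI; apply: open_comp.
(* If [x] is outside [C], then either [f z = x] forces [W z] or [fh z = x] does;
   [f] and [fh] being onto, [x] has a relative in both cases. *)
pose C := f @` (~` W) `&` fh @` (~` W).
have clC : closed C by apply: closedI; exact: closed_image.
(* The first factor of [C] excludes [a] and the second excludes [b]: by [fhP], any [z] with
   [f z = a] or [fh z = b] lies in [W]. *)
have nCa : ~ C a.
  move=> [[z nWz za] _]; apply: nWz; split; rewrite /preimage/= ?za //.
  by have /fhP -> := za.
have nCb : ~ C b.
  move=> [_ [z nWz zb]]; apply: nWz; split; rewrite /preimage/= ?zb //.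
  by have /fhP -> := zb.
pose Y := (fun z => (f z, fh z)) @` P `|` (fun z => (fh z, f z)) @` P
  `|` (fun x => (x, x)) @` C.
have sY : symmetric_set Y.
  move=> x y [[[z Pz [<- <-]]|[z Pz [<- <-]]]|[z Cz [<- <-]]].
  - by left; right; exists z.
  - by left; left; exists z.
  - by right; exists z.
exists Y, sY; apply: symmetric_closed_relation.
- apply: closedU; last exact: closed_image.
  by apply: closedU; apply: closed_image => //; exact: continuous_pair.
- move=> x; have [Cx|nCx] := EM (C x); first by exists x; right; exists x.
  have [nfx|fx] := EM ((f @` (~` W)) x); last first.
    have [z _ zx] := sf x I; exists (fh z); left; left; exists z; rewrite ?zx //.
    by apply: WP; apply: contrapT => nWz; apply: fx; exists z.
  have [z zx] := sfh x; exists (f z); left; right; exists z; rewrite ?zx //.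
  by apply: WP; apply: contrapT => nWz; apply: nCx; split=> //; exists z.
(* A pair [(f z, fh z)] starting at [a] ends at [b] by [fhP]. A transposed pair would give
   [fh z = a] in [U], against [P], and a diagonal pair would put [a] in [C]. For [b] the first two
   cases trade roles, with [V] in place of [U]. *)
- move=> y [[[z _ [/fhP zb <-]]|[z [_ nUz] [za _]]]|[x Cx [xa _]]] //.
  + by exfalso; apply: nUz; rewrite /preimage/= za.
  + by exfalso; apply: nCa; rewrite -xa.
- move=> y [[[z [nVz _] [zb _]]|[z _ [/fhP za <-]]]|[x Cx [xb _]]] //.
  + by exfalso; apply: nVz; rewrite /preimage/= zb.
  + by exfalso; apply: nCb; rewrite -xb.
Qed.
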